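(* Let $N\ge 2$, $a,b\in\mathbb{C}$, and let $\omega=e^{2\pi\sqrt{-1}/N}$. On the tensor product representation $V(\lambda_1,a)\otimes V(\lambda_{N-1},b)$ of the Yangian $Y(\mathfrak{sl}_N)$, the generators $J(T_i^{(j)})$ act on the vectors $\Psi_k^{(m)}$ by $$J(T_{i}^{(j)})\Psi^{(m)}_{k}=\Big[a\,\omega^{(j-1)(k-1)}-b\,\omega^{(i-1)(m-1)}+\frac{N}{2}\big(\delta_{i+k,2}\,\delta_{j+m,2}-\delta_{k,1}\,\delta_{m,1}\big)\omega^{(j-1)(k-1)}\Big]\Psi^{(m+j-1)}_{k+i-1}$$ for all $i,j,k,m\in\{1,\dots,N\}$ with $(i,j)\neq(1,1)$, where all indices and the Kronecker deltas are taken modulo $N$.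
   Context: All indices are read in $\mathbb{Z}_N=\mathbb{Z}/N\mathbb{Z}$ (represented by $1,\dots,N$), and Kronecker deltas compare indices modulo $N$. $E_{kl}$ are the $N\times N$ matrix units. Yangian (Drinfeld): let $\mathfrak{g}=\mathfrak{sl}_N$ with $(x,y)=\mathrm{tr}(xy)$ and let $\{x_\lambda\}$ be an orthonormal basis. $Y(\mathfrak{g})$ is the unital associative algebra generated by $x, J(x)$ ($x\in\mathfrak{g}$) with relations: the commutator $[x,y]$ in $Y(\mathfrak{g})$ equals the bracket in $\mathfrak{g}$, and $x\mapsto x$ is linear; $J(\alpha x+\beta y)=\alpha J(x)+\beta J(y)$; $[x,J(y)]=J([x,y])$; $[J(x),J([y,z])]+[J(z),J([x,y])]+[J(y),J([z,x])]=\sum_{\lambda,\mu,\nu}([x,x_\lambda],[[y,x_\mu],[z,x_\nu]])\{x_\lambda,x_\mu,x_\nu\}$; $[[J(x),J(y)],[z,J(w)]]+[[J(z),J(w)],[x,J(y)]]=\sum_{\lambda,\mu,\nu}([x,x_\lambda],[[y,x_\mu],[[z,w],x_\nu]])\{x_\lambda,x_\mu,J(x_\nu)\}$, where $\{z_1,z_2,z_3\}=\frac1{24}\sum_{\pi\in S_3}z_{\pi(1)}z_{\pi(2)}z_{\pi(3)}$. Coproduct: $\Delta(x)=x\otimes1+1\otimes x$, $\Delta(J(x))=1\otimes J(x)+J(x)\otimes 1+\frac12[x\otimes1,t]$, where $t=\sum_\lambda x_\lambda\otimes x_\lambda$. The tensor product of two modules is a module via $\Delta$. Principal basis: $A_{ij}=\sum_{k\in\mathbb{Z}_N}\omega^{ki}E_{k,k+j}$,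 and $T_i^{(j)}=\omega^{-i+1}A_{i-1,j-1}=\sum_{k}\omega^{(i-1)(k-1)}E_{k,k+j-1}$; for $(i,j)\ne(1,1)$ these form a basis of $\mathfrak{sl}_N$. Modules: $V(\lambda_1)=\mathbb{C}^N$ is the natural representation with standard basis $|1\rangle_1,\dots,|N\rangle_1$, and $V(\lambda_{N-1})$ is its dual with dual basis $|1\rangle_2,\dots,|N\rangle_2$. For $c\in\mathbb{C}$, $V(\lambda_i,c)$ ($i=1,N-1$) is the $Y(\mathfrak{sl}_N)$-module on $V(\lambda_i)$ in which $x\in\mathfrak{sl}_N$ acts as usual and $J(x)$ acts as $c\,x$ (it is known that this is a well-defined module). Put $|i,j\rangle=|i\rangle_1\otimes|j\rangle_2$ and $\Psi_k^{(m)}=\sum_{r=1}^N\omega^{(k-1)(r-1)}|r,m+r-1\rangle$ for $k,m\in\{1,\dots,N\}$ (a basis of the tensor product, the generalized Bell states).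
   Formalization: The last defining relation of the Yangian is taken in Drinfeld's form, with the same sum with (x,y) and (z,w) exchanged added on the right; with the single printed sum the tensor product is not a module (already for N=2). The operators J(x) and the formula are unaffected. *)

(* Defs.v *)
From HB Require Import structures.
From mathcomp Require Import all_boot all_order all_algebra.
From mathcomp Require Import complex mxtens.
From mathcomp Require Import reals trigo.

Set Implicit Arguments.
Unset Strict Implicit.
Unset Printing Implicit Defensive.

Import Order.TTheory GRing.Theory Num.Theory.
Local Open Scope ring_scope.

Definition bracket {F : pzRingType} {d : nat} (x y : 'M[F]_d) : 'M[F]_d :=
  x *m y - y *m x.

Definition trform {F : pzRingType} {d : nat} (x y : 'M[F]_d) : F := \tr (x *m y).

(* {z1, z2, z3} = 1/24 sum_{pi in S_3} z_pi(1) z_pi(2) z_pi(3) *)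
Definition ysym {F : fieldType} {d : nat} (z1 z2 z3 : 'M[F]_d) : 'M[F]_d :=
  24%:R^-1 *: (z1 *m z2 *m z3 + z1 *m z3 *m z2 + z2 *m z1 *m z3
             + z2 *m z3 *m z1 + z3 *m z1 *m z2 + z3 *m z2 *m z1).

Record sl_orthonormal_basis (F : fieldType) (N : nat) := SlOrthonormalBasis {
  sl_basis :> 'I_(N ^ 2).-1 -> 'M[F]_N;
  sl_basis_traceless : forall l, \tr (sl_basis l) = 0;
  sl_basis_orthonormal :
    forall l m, trform (sl_basis l) (sl_basis m) = (l == m)%:R;
  sl_basis_span : forall x : 'M[F]_N, \tr x = 0 ->
    exists c : 'I_(N ^ 2).-1 -> F, x = \sum_l c l *: sl_basis l
}.

Definition ycubic {F : fieldType} {N d : nat} (B : sl_orthonormal_basis F N)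
    (X1 X2 X3 : 'M[F]_N -> 'M[F]_d) (x y z : 'M[F]_N) : 'M[F]_d :=
  \sum_l \sum_m \sum_n
    trform (bracket x (B l)) (bracket (bracket y (B m)) (bracket z (B n)))
      *: ysym (X1 (B l)) (X2 (B m)) (X3 (B n)).

(* Defining relations of Y(sl_N) for the operators X x, J x on F^d by which the
   generators x, J(x) act; sl_N is the set of traceless matrices, and the values
   of X and J at other matrices are irrelevant. The right-hand side of the last
   relation is Drinfeld's, symmetric under (x,y) <-> (z,w) as the left-hand side
   is: the first sum alone does not define a bialgebra, since it already fails on
   the tensor products below. *)
Record yangian_relations (F : fieldType) (N d : nat)
    (B : sl_orthonormal_basis F N) (X J : 'M[F]_N -> 'M[F]_d) : Prop := {
  yang_X_linear : forall (s t : F) (x y : 'M[F]_N), \tr x = 0 -> \tr y = 0 ->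
    X (s *: x + t *: y) = s *: X x + t *: X y;
  yang_X_bracket : forall x y : 'M[F]_N, \tr x = 0 -> \tr y = 0 ->
    bracket (X x) (X y) = X (bracket x y);
  yang_J_linear : forall (s t : F) (x y : 'M[F]_N), \tr x = 0 -> \tr y = 0 ->
    J (s *: x + t *: y) = s *: J x + t *: J y;
  yang_XJ_bracket : forall x y : 'M[F]_N, \tr x = 0 -> \tr y = 0 ->
    bracket (X x) (J y) = J (bracket x y);
  yang_JJ : forall x y z : 'M[F]_N, \tr x = 0 -> \tr y = 0 -> \tr z = 0 ->
    bracket (J x) (J (bracket y z)) + bracket (J z) (J (bracket x y))
      + bracket (J y) (J (bracket z x))
    = ycubic B X X X x y z;
  yang_JJJ : forall x y z w : 'M[F]_N,
    \tr x = 0 -> \tr y = 0 -> \tr z = 0 -> \tr w = 0 ->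
    bracket (bracket (J x) (J y)) (bracket (X z) (J w))
      + bracket (bracket (J z) (J w)) (bracket (X x) (J y))
    = ycubic B X X J x y (bracket z w) + ycubic B X X J z w (bracket x y)
}.

Record yangian_module (F : fieldType) (N : nat) (B : sl_orthonormal_basis F N)
    (d : nat) := YangianModule {
  act : 'M[F]_N -> 'M[F]_d;
  actJ : 'M[F]_N -> 'M[F]_d;
  actP : yangian_relations B act actJ
}.

(* Delta(x) and Delta(J(x)) acting on the tensor product of two modules *)
Definition coproduct_act (F : fieldType) (N d1 d2 : nat)
    (B : sl_orthonormal_basis F N)
    (V1 : yangian_module B d1) (V2 : yangian_module B d2) (x : 'M[F]_N) :
    'M[F]_(d1 * d2) :=
  act V1 x *t 1%:M + 1%:M *t act V2 x.

Definition coproduct_actJ (F : fieldType) (N d1 d2 : nat)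
    (B : sl_orthonormal_basis F N)
    (V1 : yangian_module B d1) (V2 : yangian_module B d2) (x : 'M[F]_N) :
    'M[F]_(d1 * d2) :=
  let t := \sum_l act V1 (B l) *t act V2 (B l) in
  1%:M *t actJ V2 x + actJ V1 x *t 1%:M + 2%:R^-1 *: bracket (act V1 x *t 1%:M) t.

(* From here to [tensor_relations]: proofs that V(lambda_1, c), V(lambda_{N-1}, c)
   and the tensor product satisfy the relations, by normalizing polynomials in
   words and traces of words over matrix letters. *)

Section TraceWords.
Let mulzE (a b : int) : intRing.mulz a b = a * b. Proof. by []. Qed.
Let addzE (a b : int) : intZmod.addz a b = a + b. Proof. by []. Qed.
Let oppzE (a : int) : intZmod.oppz a = - a. Proof. by []. Qed.

Variables (F : fieldType) (N : nat).
Implicit Types (e : nat -> 'M[F]_N) (w t : seq nat) (ts : seq (seq nat)).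

Definition wsem e w : 'M[F]_N := foldr (fun i M => e i *m M) 1%:M w.
Definition tsem e ts : F := \prod_(t <- ts) \tr (wsem e t).

Definition tmon := (int * seq (seq nat))%type.
Definition tmsem e (m : tmon) : F := m.1%:~R * tsem e m.2.
Definition tpsem e (p : seq tmon) : F := \sum_(m <- p) tmsem e m.

Definition mon := (tmon * seq nat)%type.
Definition msem e (m : mon) : 'M[F]_N := tmsem e m.1 *: wsem e m.2.
Definition psem e (p : seq mon) : 'M[F]_N := \sum_(m <- p) msem e m.

Definition pvar i : seq mon := [:: (1%Z, [::], [:: i])].
Definition psc i : seq mon := [:: (1%Z, [:: [:: i]], [::])].
Definition popp (p : seq mon) : seq mon :=
  [seq (intZmod.oppz m.1.1, m.1.2, m.2) | m <- p].
Definition pmul (p q : seq mon) : seq mon :=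
  [seq (intRing.mulz m.1.1 k.1.1, m.1.2 ++ k.1.2, m.2 ++ k.2) | m <- p, k <- q].
Definition ptr (p : seq mon) : seq mon := [seq (m.1.1, m.2 :: m.1.2, [::]) | m <- p].
Definition ptrace (p : seq mon) : seq tmon := [seq (m.1.1, m.2 :: m.1.2) | m <- p].
Definition tscale (c : int) (p : seq tmon) : seq tmon :=
  [seq (intRing.mulz c m.1, m.2) | m <- p].

Lemma wsem_cat e w1 w2 : wsem e (w1 ++ w2) = wsem e w1 *m wsem e w2.
Proof. by elim: w1 => [|i w IH] /=; rewrite ?mul1mx // IH mulmxA. Qed.

Lemma tsem_cat e a b : tsem e (a ++ b) = tsem e a * tsem e b.
Proof. by rewrite /tsem big_cat. Qed.

Lemma tsem_cons e t ts : tsem e (t :: ts) = \tr (wsem e t) * tsem e ts.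
Proof. by rewrite /tsem big_cons. Qed.

Lemma psem_pvar e i : psem e (pvar i) = e i.
Proof.
by rewrite /psem big_seq1 /msem /tmsem /tsem big_nil /= mulr1 scale1r mulmx1.
Qed.

Lemma psem_psc e i : psem e (psc i) = (\tr (e i))%:M.
Proof.
by rewrite /psem big_seq1 /msem /tmsem /tsem big_seq1 /= mul1r mulmx1 scalemx1.
Qed.

Lemma psem_cat e p q : psem e (p ++ q) = psem e p + psem e q.
Proof. by rewrite /psem big_cat. Qed.

Lemma psem_popp e p : psem e (popp p) = - psem e p.
Proof.
rewrite /psem big_map -sumrN; apply: eq_bigr => m _.
by rewrite /msem /tmsem /= oppzE mulrNz mulNr scaleNr.
Qed.

Lemma psem_pmul e p q : psem e (pmul p q) = psem e p *m psem e q.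
Proof.
rewrite /psem /pmul big_allpairs_dep mulmx_suml; apply: eq_bigr => m _.
rewrite mulmx_sumr; apply: eq_bigr => k _.
rewrite /msem /tmsem /= wsem_cat tsem_cat -scalemxAl -scalemxAr scalerA.
by congr (_ *: _); rewrite mulzE intrM mulrACA.
Qed.

Lemma tpsem_ptrace e p : tpsem e (ptrace p) = \tr (psem e p).
Proof.
rewrite /tpsem /psem big_map raddf_sum; apply: eq_bigr => m _ /=.
by rewrite /msem /tmsem /= mxtraceZ tsem_cons -mulrA [\tr _ * _]mulrC.
Qed.

Lemma psem_ptr e p : psem e (ptr p) = (\tr (psem e p))%:M.
Proof.
rewrite -tpsem_ptrace /tpsem /psem !big_map raddf_sum; apply: eq_bigr => m _ /=.
by rewrite /msem /= scalemx1 /tmsem /=.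
Qed.

Lemma tpsem_cat e p q : tpsem e (p ++ q) = tpsem e p + tpsem e q.
Proof. by rewrite /tpsem big_cat. Qed.

Lemma tpsem_tscale e c p : tpsem e (tscale c p) = c%:~R * tpsem e p.
Proof.
rewrite /tpsem big_map mulr_sumr; apply: eq_bigr => m _.
by rewrite /tmsem /= mulzE intrM mulrA.
Qed.

Lemma trw_rot e k t : \tr (wsem e (rot k t)) = \tr (wsem e t).
Proof. by rewrite /rot wsem_cat mxtrace_mulC -wsem_cat cat_take_drop. Qed.

(* zero test up to cyclic rotation of the words and order of the traces *)
Fixpoint lexle (s t : seq nat) : bool :=
  match s, t with
  | [::], _ => true
  | _, [::] => false
  | a :: s', b :: t' => if a == b then lexle s' t' else (a < b)%N
  end.

Definition minrot t : seq nat :=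
  foldr (fun k u => if lexle (rot k t) u then rot k t else u) t (iota 0 (size t)).
Definition canon ts : seq (seq nat) := sort lexle [seq minrot t | t <- ts].

Fixpoint addmon (m : tmon) (p : seq tmon) : seq tmon :=
  match p with
  | [::] => [:: m]
  | k :: p' => if k.2 == m.2 then (intZmod.addz k.1 m.1, k.2) :: p'
               else k :: addmon m p'
  end.
Definition collect (p : seq tmon) : seq tmon :=
  foldl (fun q m => addmon (m.1, canon m.2) q) [::] p.
Definition zerop (p : seq tmon) : bool := all (fun m => m.1 == 0) (collect p).

Lemma tr_minrot e t : \tr (wsem e (minrot t)) = \tr (wsem e t).
Proof.
rewrite /minrot; elim: iota => //= k s IH.
by case: ifP => // _; rewrite trw_rot.
Qed.

Lemma tsem_canon e ts : tsem e (canon ts) = tsem e ts.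
Proof.
rewrite /tsem /canon (perm_big _ (permEl (perm_sort _ _))) big_map.
by apply: eq_bigr => t _; rewrite tr_minrot.
Qed.

Lemma tpsem_addmon e m p : tpsem e (addmon m p) = tmsem e m + tpsem e p.
Proof.
rewrite /tpsem; elim: p => [|k p IH] /=; first by rewrite big_seq1 big_nil addr0.
case: eqP => [E|_]; rewrite !big_cons; last by rewrite IH addrCA.
rewrite addrA; congr (_ + _).
by rewrite /tmsem /= E addzE intrD mulrDl addrC.
Qed.

Lemma tpsem_collect e p : tpsem e (collect p) = tpsem e p.
Proof.
rewrite /collect -[RHS]add0r -[0]/(0 : F).
have <- : tpsem e [::] = 0 by rewrite /tpsem big_nil.
elim: p [::] => [|m p IH] q /=; first by rewrite {3}/tpsem big_nil addr0.
rewrite IH tpsem_addmon [in RHS]/tpsem big_cons -/(tpsem e p) addrCA addrA.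
by congr (_ + _ + _); rewrite /tmsem /= tsem_canon.
Qed.

Lemma zeropP e p : zerop p -> tpsem e p = 0.
Proof.
rewrite -(tpsem_collect e) /zerop /tpsem => /allP h.
by rewrite big_seq big1 // => m /h /eqP m0; rewrite /tmsem m0 mul0r.
Qed.

(* contraction of a pair of letters u, v standing for E_ij, E_ji *)
Definition upd e (u v : nat) A B : nat -> 'M[F]_N :=
  fun k => if k == u then A else if k == v then B else e k.

Fixpoint pull (u : nat) ts : option (seq nat * seq (seq nat)) :=
  match ts with
  | [::] => None
  | t :: ts' => if u \in t then Some (behead (rot (index u t) t), ts')
                else if pull u ts' is Some (r, q) then Some (r, t :: q) else None
  end.

Definition contract1 (u v : nat) (m : tmon) : option tmon :=
  if pull u m.2 is Some (A, q) then
    if v \in A then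
      let A1 := take (index v A) A in let A2 := drop (index v A).+1 A in
      let r := A1 :: A2 :: q in
      if all (fun t => (u \notin t) && (v \notin t)) r then Some (m.1, r) else None
    else if pull v q is Some (B, q') then
      let r := (A ++ B) :: q' in
      if all (fun t => (u \notin t) && (v \notin t)) r then Some (m.1, r) else None
    else None
  else None.

Fixpoint contract (u v : nat) (p : seq tmon) : option (seq tmon) :=
  match p with
  | [::] => Some [::]
  | m :: p' => match contract1 u v m, contract u v p' with
               | Some m', Some q => Some (m' :: q)
               | _, _ => None
               end
  end.

Lemma pullP e u ts A q : pull u ts = Some (A, q) ->
  tsem e ts = \tr (wsem e (u :: A)) * tsem e q.
Proof.
elim: ts A q => //= t ts IH A q; case: ifP => [ut|_].
  case=> <- <-; rewrite tsem_cons -(trw_rot e (index u t) t).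
  suff {1}-> : rot (index u t) t = u :: behead (rot (index u t) t) by [].
  have h : (index u t < size t)%N by rewrite index_mem.
  by rewrite /rot (drop_nth u h) /= nth_index.
case: (pull u ts) IH => // -[r q'] IH [<- <-].
by rewrite !tsem_cons (IH r q') // mulrCA.
Qed.

Lemma wsem_upd e u v A B t : u \notin t -> v \notin t ->
  wsem (upd e u v A B) t = wsem e t.
Proof.
elim: t => //= k t IH; rewrite !inE !negb_or => /andP[uk ut] /andP[vk vt].
by rewrite IH // /upd eq_sym (negPf uk) eq_sym (negPf vk).
Qed.

Lemma tsem_upd e u v A B ts : all (fun t => (u \notin t) && (v \notin t)) ts ->
  tsem (upd e u v A B) ts = tsem e ts.
Proof.
move=> /allP h; rewrite /tsem big_seq [RHS]big_seq; apply: eq_bigr => t /h.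
by case/andP=> ut vt; rewrite wsem_upd.
Qed.

Lemma tr_delta (A : 'M[F]_N) i j : \tr (delta_mx i j *m A) = A j i.
Proof.
rewrite /mxtrace (bigD1 i) //= big1 ?addr0 => [|k ki].
  rewrite mxE (bigD1 j) //= big1 ?addr0 ?mxE ?eqxx ?mul1r // => l lj.
  by rewrite mxE (negPf lj) andbF mul0r.
by rewrite mxE big1 // => l _; rewrite mxE (negPf ki) mul0r.
Qed.

Lemma contract_tr2 (A B : 'M[F]_N) :
  \sum_i \sum_j \tr (delta_mx i j *m A) * \tr (delta_mx j i *m B)
  = \tr (A *m B).
Proof.
rewrite /mxtrace exchange_big; apply: eq_bigr => i _ /=; rewrite mxE.
by apply: eq_bigr => j _; rewrite -!/(mxtrace _) !tr_delta.
Qed.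

Lemma contract_tr1 (A B : 'M[F]_N) :
  \sum_i \sum_j \tr (delta_mx i j *m (A *m (delta_mx j i *m B)))
  = \tr A * \tr B.
Proof.
rewrite /mxtrace mulr_suml exchange_big; apply: eq_bigr => i _ /=.
rewrite mulr_sumr; apply: eq_bigr => j _; rewrite -!/(mxtrace _) tr_delta.
rewrite mxE (bigD1 i) //= big1 ?addr0 => [|k ki].
  congr (_ * _); rewrite mxE (bigD1 j) //= big1 ?addr0 => [|l lj].
    by rewrite mxE !eqxx mul1r.
  by rewrite mxE (negPf lj) andbF mul0r.
by rewrite mxE big1 ?mulr0 // => l _; rewrite mxE (negPf ki) mul0r.
Qed.

Lemma contract1P e u v m m' : u != v -> contract1 u v m = Some m' ->
  \sum_i \sum_j tmsem (upd e u v (delta_mx i j) (delta_mx j i)) m = tmsem e m'.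
Proof.
move=> uv; rewrite /contract1; case E: (pull u m.2) => [[A q]|] //.
have updu X Y : upd e u v X Y u = X by rewrite /upd eqxx.
have updv X Y : upd e u v X Y v = Y by rewrite /upd eq_sym (negPf uv) eqxx.
case: ifP => [vA|vA].
  have EA : A = take (index v A) A ++ v :: drop (index v A).+1 A.
    have hA : (index v A < size A)%N by rewrite index_mem.
    by rewrite -{1}(cat_take_drop (index v A) A) (drop_nth 0%N hA) nth_index.
  move: (take _ _) (drop _ _) EA => A1 A2 EA; rewrite /=.
  case: ifP => // /and3P[/andP[u1 v1] /andP[u2 v2] hq] [<-].
  rewrite [RHS]/tmsem /= !tsem_cons [X in _ = _ * X]mulrA -contract_tr1.
  rewrite mulr_suml mulr_sumr; apply: eq_bigr => i _.
  rewrite mulr_suml mulr_sumr; apply: eq_bigr => j _.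
  rewrite /tmsem (pullP _ E) tsem_upd // EA /= wsem_cat /= updu updv.
  by rewrite !wsem_upd.
case E2: (pull v q) => [[B q']|] //=.
case: ifP => // /andP[]; rewrite !mem_cat !negb_or => /andP[] /andP[uA uB] /andP[vA' vB] hq [<-].
rewrite [RHS]/tmsem /= !tsem_cons wsem_cat -contract_tr2.
rewrite mulr_suml mulr_sumr; apply: eq_bigr => i _.
rewrite mulr_suml mulr_sumr; apply: eq_bigr => j _.
rewrite /tmsem (pullP _ E) (pullP _ E2) tsem_upd //= updu updv !wsem_upd //.
by rewrite !mulrA.
Qed.

Lemma contractP e u v p q : u != v -> contract u v p = Some q ->
  \sum_i \sum_j tpsem (upd e u v (delta_mx i j) (delta_mx j i)) p = tpsem e q.
Proof.
move=> uv; elim: p q => [|m p IH] q /=.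
  by case=> <-; rewrite /tpsem big_nil big1 // => i _; rewrite big1 // => j _; rewrite big_nil.
case E1: contract1 => [m'|] //; case E2: contract => [q'|] // [<-].
rewrite [RHS]/tpsem big_cons -(contract1P e uv E1) -/(tpsem e q') -(IH _ E2).
rewrite -big_split; apply: eq_bigr => i _; rewrite -big_split; apply: eq_bigr => j _.
by rewrite /tpsem big_cons.
Qed.
End TraceWords.

(* Syntactic operators; letters 0, ..., 4 are x, y, z, w and the argument, 5 is
   the test matrix, 6 and 7 have traces 2a and 2b, and (8, 9), (10, 11) are the
   contracted pairs. *)
Definition pbr (p q : seq mon) : seq mon := pmul p q ++ popp (pmul q p).
Definition pJ (u p : seq mon) : seq mon :=
  pmul (psc 6) (pmul u p) ++ (popp (pmul (psc 7) (pmul p u)) ++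
  (popp (pmul (ptr p) u) ++ ptr (pmul u p))).
Definition pobr (f g : seq mon -> seq mon) p := f (g p) ++ popp (g (f p)).
Definition posym (f g h : seq mon -> seq mon) p :=
  f (g (h p)) ++ (f (h (g p)) ++ (g (f (h p)) ++ (g (h (f p)) ++
  (h (f (g p)) ++ h (g (f p)))))).
Definition pcub (x y z : seq mon) :=
  pbr (pbr (pbr y (pvar 8)) (pbr z (pvar 10))) x.

Definition checkrel (L R : seq mon) : bool :=
  let tr5 p := ptrace (pmul (pvar 5) p) in
  if contract 10 11 (tr5 R) is Some q1 then
    if contract 8 9 q1 is Some q2 then
      zerop (tscale 6 (tr5 L) ++ tscale (-1) q2)
    else false
  else false.

Definition nat_rhs : seq mon :=
  posym (pmul (pcub (pvar 0) (pvar 1) (pvar 2)))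
    (pmul (pvar 9)) (pmul (pvar 11)) (pvar 4).
Definition JJ_lhs : seq mon :=
  pobr (pJ (pvar 0)) (pJ (pbr (pvar 1) (pvar 2))) (pvar 4)
  ++ (pobr (pJ (pvar 2)) (pJ (pbr (pvar 0) (pvar 1))) (pvar 4)
  ++ pobr (pJ (pvar 1)) (pJ (pbr (pvar 2) (pvar 0))) (pvar 4)).
Definition JJ_rhs : seq mon :=
  posym (pbr (pcub (pvar 0) (pvar 1) (pvar 2)))
    (pbr (pvar 9)) (pbr (pvar 11)) (pvar 4).
Definition JJJ_lhs : seq mon :=
  pobr (pobr (pJ (pvar 0)) (pJ (pvar 1)))
       (pobr (pbr (pvar 2)) (pJ (pvar 3))) (pvar 4)
  ++ pobr (pobr (pJ (pvar 2)) (pJ (pvar 3)))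
       (pobr (pbr (pvar 0)) (pJ (pvar 1))) (pvar 4).
Definition JJJ_rhs : seq mon :=
  posym (pbr (pcub (pvar 0) (pvar 1) (pbr (pvar 2) (pvar 3))))
    (pbr (pvar 9)) (pJ (pvar 11)) (pvar 4)
  ++ posym (pbr (pcub (pvar 2) (pvar 3) (pbr (pvar 0) (pvar 1))))
    (pbr (pvar 9)) (pJ (pvar 11)) (pvar 4).

Lemma nat_check : checkrel [::] nat_rhs. Proof. by vm_compute. Qed.
Lemma JJ_check : checkrel JJ_lhs JJ_rhs. Proof. by vm_compute. Qed.
Lemma JJJ_check : checkrel JJJ_lhs JJJ_rhs. Proof. by vm_compute. Qed.

Section Identities.
Variables (F : numFieldType) (N : nat).
Hypothesis N_gt0 : (0 < N)%N.
Local Notation mx := 'M[F]_N.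
Implicit Types (x y z w M D : mx) (f g h : mx -> mx).

Definition sJ (a b : F) x M : mx :=
  a *: (x *m M) - b *: (M *m x) - \tr M *: x + (\tr (x *m M))%:M.
Definition sobr f g M : mx := f (g M) - g (f M).
Definition sosym f g h M : mx :=
  f (g (h M)) + f (h (g M)) + g (f (h M)) + g (h (f M)) + h (f (g M)) + h (g (f M)).
Definition scub x y z A B : mx :=
  bracket (bracket (bracket y A) (bracket z B)) x.

Definition env (a b : F) x y z w M D : nat -> mx :=
  nth 0 [:: x; y; z; w; M; D; (a / N%:R)%:M; (b / N%:R)%:M].

Let N_neq0 : (N%:R : F) != 0. Proof. by rewrite pnatr_eq0 -lt0n. Qed.

Lemma tr_eq (A B : mx) : (forall D, \tr (D *m A) = \tr (D *m B)) -> A = B.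
Proof. by move=> h; apply/matrixP => i j; rewrite -!tr_delta h. Qed.

Lemma checkrelP (L R : seq mon) (e : mx -> nat -> mx)
    (A : mx) (C : 'I_N -> 'I_N -> 'I_N -> 'I_N -> mx) :
  checkrel L R -> (forall D, e D 5%N = D) -> (forall D, psem (e D) L = A) ->
  (forall D i j k l, psem (upd (upd (e D) 8 9 (delta_mx i j) (delta_mx j i))
                  10 11 (delta_mx k l) (delta_mx l k)) R = C i j k l) ->
  6%:R *: A = \sum_i \sum_j \sum_k \sum_l C i j k l.
Proof.
rewrite /checkrel; case E1: contract => [q1|] //; case E2: contract => [q2|] //.
move=> h e5 hL hR; apply: tr_eq => D; have := zeropP (e D) h.
rewrite tpsem_cat !tpsem_tscale tpsem_ptrace psem_pmul psem_pvar e5 hL.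
rewrite -(contractP (e D) _ E2) // mulN1r => /eqP; rewrite subr_eq0 => /eqP.
rewrite -scalemxAr mxtraceZ => ->; rewrite mulmx_sumr raddf_sum.
apply: eq_bigr => i _; rewrite mulmx_sumr raddf_sum; apply: eq_bigr => j _.
rewrite -(contractP _ _ E1) // mulmx_sumr raddf_sum.
apply: eq_bigr => k _; rewrite mulmx_sumr raddf_sum; apply: eq_bigr => l _.
by rewrite tpsem_ptrace psem_pmul psem_pvar hR /upd /= e5.
Qed.

Lemma psem_pbr (e : nat -> mx) p q :
  psem e (pbr p q) = bracket (psem e p) (psem e q).
Proof. by rewrite /pbr psem_cat psem_popp !psem_pmul. Qed.

Lemma psem_pJ (e : nat -> mx) a b u p : \tr (e 6%N) = a -> \tr (e 7%N) = b ->
  psem e (pJ u p) = sJ a b (psem e u) (psem e p).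
Proof.
have cat4 p1 p2 p3 p4 : psem e (p1 ++ (p2 ++ (p3 ++ p4)))
    = psem e p1 + psem e p2 + psem e p3 + psem e p4.
  by rewrite !psem_cat !addrA.
move=> <- <-; rewrite /pJ /sJ cat4 !psem_popp psem_ptr !psem_pmul.
by rewrite !psem_psc psem_ptr !mul_scalar_mx.
Qed.

Lemma psem_pobr (e : nat -> mx) (pf pg : seq mon -> seq mon) f g :
  (forall p, psem e (pf p) = f (psem e p)) ->
  (forall p, psem e (pg p) = g (psem e p)) ->
  forall p, psem e (pobr pf pg p) = sobr f g (psem e p).
Proof. by move=> hf hg p; rewrite /pobr psem_cat psem_popp !(hf, hg). Qed.

Lemma psem_posym (e : nat -> mx) (pf pg ph : seq mon -> seq mon) f g h :
  (forall p, psem e (pf p) = f (psem e p)) ->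
  (forall p, psem e (pg p) = g (psem e p)) ->
  (forall p, psem e (ph p) = h (psem e p)) ->
  forall p, psem e (posym pf pg ph p) = sosym f g h (psem e p).
Proof.
by move=> hf hg hh p; rewrite /posym !psem_cat !(hf, hg, hh) /sosym !addrA.
Qed.

Lemma tr_scal (c : F) : \tr ((c / N%:R)%:M : mx) = c.
Proof. by rewrite mxtrace_scalar -[_ *+ N]mulr_natr divfK. Qed.

Lemma nat_identity x y z :
  \sum_i \sum_j \sum_k \sum_l
     sosym (mulmx (scub x y z (delta_mx i j) (delta_mx k l)))
           (mulmx (delta_mx j i)) (mulmx (delta_mx l k)) 1%:M = 0 :> mx.
Proof.
rewrite -(checkrelP (e := env 0 0 x y z 0 1%:M) (A := 0) nat_check) ?scaler0 //.
- by move=> D; rewrite /psem big_nil.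
move=> D i j k l.
by rewrite /nat_rhs (psem_posym (psem_pmul _ _) (psem_pmul _ _) (psem_pmul _ _))
  /pcub !psem_pbr !psem_pvar.
Qed.

Lemma JJ_identity a b x y z M :
  6%:R *: (sobr (sJ a b x) (sJ a b (bracket y z)) M
    + sobr (sJ a b z) (sJ a b (bracket x y)) M
    + sobr (sJ a b y) (sJ a b (bracket z x)) M)
  = \sum_i \sum_j \sum_k \sum_l
     sosym (bracket (scub x y z (delta_mx i j) (delta_mx k l)))
           (bracket (delta_mx j i)) (bracket (delta_mx l k)) M.
Proof.
apply: (checkrelP (e := env a b x y z 0 M) JJ_check) => //.
- move=> D; set e := env _ _ _ _ _ _ _ _.
  have hJ u p : psem e (pJ u p) = sJ a b (psem e u) (psem e p).
    by apply: psem_pJ; apply: tr_scal.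
  have cat3 p1 p2 p3 : psem e (p1 ++ (p2 ++ p3))
      = psem e p1 + psem e p2 + psem e p3 by rewrite !psem_cat addrA.
  by rewrite /JJ_lhs cat3 !(psem_pobr (hJ _) (hJ _)) !psem_pbr !psem_pvar.
move=> D i j k l.
by rewrite /JJ_rhs (psem_posym (psem_pbr _ _) (psem_pbr _ _) (psem_pbr _ _))
  /pcub !psem_pbr !psem_pvar.
Qed.

Lemma JJJ_identity a b x y z w M :
  6%:R *: (sobr (sobr (sJ a b x) (sJ a b y)) (sobr (bracket z) (sJ a b w)) M
    + sobr (sobr (sJ a b z) (sJ a b w)) (sobr (bracket x) (sJ a b y)) M)
  = \sum_i \sum_j \sum_k \sum_l
    (sosym (bracket (scub x y (bracket z w) (delta_mx i j) (delta_mx k l)))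
           (bracket (delta_mx j i)) (sJ a b (delta_mx l k)) M
    + sosym (bracket (scub z w (bracket x y) (delta_mx i j) (delta_mx k l)))
           (bracket (delta_mx j i)) (sJ a b (delta_mx l k)) M).
Proof.
apply: (checkrelP (e := env a b x y z w M) JJJ_check) => //.
- move=> D; set e := env _ _ _ _ _ _ _ _.
  have hJ u p : psem e (pJ u p) = sJ a b (psem e u) (psem e p).
    by apply: psem_pJ; apply: tr_scal.
  have hJJ u v := psem_pobr (hJ u) (hJ v).
  have hXJ u v := psem_pobr (psem_pbr e u) (hJ v).
  by rewrite /JJJ_lhs psem_cat !(psem_pobr (hJJ _ _) (hXJ _ _)) !psem_pvar.
move=> D i j k l; set e := upd _ _ _ _ _.
have hJ u p : psem e (pJ u p) = sJ a b (psem e u) (psem e p).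
  by apply: psem_pJ; apply: tr_scal.
rewrite /JJJ_rhs psem_cat; congr (_ + _);
  rewrite (psem_posym (psem_pbr e _) (psem_pbr e _) (hJ _));
  by rewrite /pcub !psem_pbr !psem_pvar.
Qed.

End Identities.

Section CasimirSums.
Variables (F : numFieldType) (N : nat) (B : sl_orthonormal_basis F N).
Local Notation mx := 'M[F]_N.
Implicit Type V : lmodType F.

Definition islin V (f : mx -> V) : Prop :=
  forall k u v, f (k *: u + v) = k *: f u + f v.

Lemma islin0 V (f : mx -> V) : islin f -> f 0 = 0.
Proof.
move=> hf; have := hf 1 0 0; rewrite !scale1r addr0 => /(congr1 (+%R^~ (- f 0))).
by rewrite subrr addrK.
Qed.

Lemma islinZ V (f : mx -> V) k u : islin f -> f (k *: u) = k *: f u.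
Proof. by move=> hf; rewrite -[k *: u]addr0 hf islin0 // addr0. Qed.

Lemma islin_sum V (f : mx -> V) (I : finType) (c : I -> F) (u : I -> mx) :
  islin f -> f (\sum_i c i *: u i) = \sum_i c i *: f (u i).
Proof.
move=> hf; elim/big_rec2: _ => [|i y z _ <-]; first exact: islin0.
by rewrite hf.
Qed.

Lemma islin_comp V (f : mx -> V) (g : mx -> mx) :
  islin f -> islin g -> islin (f \o g).
Proof. by move=> hf hg k u v; rewrite /= hg hf. Qed.

Lemma islin_brl (y : mx) : islin (bracket y).
Proof.
move=> k u v; rewrite /bracket mulmxDr mulmxDl -scalemxAr -scalemxAl scalerBr.
by rewrite opprD addrACA.
Qed.

Lemma islin_brr (y : mx) : islin (bracket^~ y).
Proof.
move=> k u v; rewrite /bracket mulmxDr mulmxDl -scalemxAr -scalemxAl scalerBr.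
by rewrite opprD addrACA.
Qed.

Lemma tr_bracket (x y : mx) : \tr (bracket x y) = 0.
Proof. by rewrite /bracket raddfB /= mxtrace_mulC subrr. Qed.

Lemma trformA (x y z : mx) : trform (bracket x y) z = trform (bracket z x) y.
Proof.
rewrite /trform /bracket !mulmxBl !raddfB /= -!mulmxA; congr (_ - _).
  by rewrite [RHS]mxtrace_mulC -mulmxA.
by rewrite mxtrace_mulC -mulmxA.
Qed.

Lemma basis_expand (A : mx) : \tr A = 0 ->
  A = \sum_l trform A (B l) *: B l.
Proof.
move=> /(sl_basis_span B)[c EA]; rewrite {1}EA; apply: eq_bigr => l _.
congr (_ *: _); rewrite EA /trform mulmx_suml raddf_sum (bigD1 l) //= big1.
  by rewrite addr0 -scalemxAl mxtraceZ -/(trform _ _) sl_basis_orthonormal eqxx mulr1.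
move=> m ml; rewrite -scalemxAl mxtraceZ -/(trform _ _) sl_basis_orthonormal.
by rewrite (negPf ml) mulr0.
Qed.

Lemma basis_expand_gl (A : mx) :
  \sum_l trform A (B l) *: B l = A - (\tr A / N%:R)%:M.
Proof.
case: (posnP N) => [N0|N_gt0].
  have flat (U W : mx) : U = W by apply/matrixP => i; have := ltn_ord i; rewrite {2}N0.
  exact: flat.
rewrite [RHS]basis_expand; last first.
  by rewrite raddfB /= tr_scal // subrr.
apply: eq_bigr => l _; congr (_ *: _); rewrite /trform mulmxBl raddfB /=.
by rewrite mul_scalar_mx mxtraceZ sl_basis_traceless mulr0 subr0.
Qed.

Lemma casimir V (H : mx -> mx -> V) :
  (forall v, islin (H^~ v)) -> (forall u, islin (H u)) ->
  (forall v, H 1%:M v = 0) ->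
  \sum_m H (B m) (B m) = \sum_i \sum_j H (delta_mx i j) (delta_mx j i).
Proof.
move=> Hl Hr H1.
have E m : H (B m) (B m) =
    \sum_(p : 'I_N * 'I_N) (B m) p.2 p.1 *: H (B m) (delta_mx p.2 p.1).
  rewrite -(islin_sum _ _ (Hr (B m))); congr (H _ _).
  by rewrite [LHS]matrix_sum_delta exchange_big pair_bigA.
rewrite (eq_bigr _ (fun m _ => E m)) exchange_big [RHS]pair_bigA /=.
apply: eq_bigr => p _.
rewrite -(islin_sum (fun m => (B m) p.2 p.1) (fun m => B m) (Hl _)).
rewrite (_ : \sum_i _ = 1 *: delta_mx p.1 p.2 - (\tr (delta_mx p.1 p.2) / N%:R) *: 1%:M).
  by rewrite scale1r -scaleNr addrC Hl H1 scaler0 add0r.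
rewrite scale1r scalemx1 -basis_expand_gl.
by apply: eq_bigr => m _; rewrite /trform tr_delta.
Qed.

Lemma cubic_sum V (G : mx -> mx -> mx -> V) (x y z : mx) :
  (forall b c, islin (fun a => G a b c)) ->
  (forall a c, islin (fun b => G a b c)) ->
  (forall a b, islin (G a b)) ->
  \sum_l \sum_m \sum_n
    trform (bracket x (B l)) (bracket (bracket y (B m)) (bracket z (B n)))
      *: G (B l) (B m) (B n)
  = \sum_i \sum_j \sum_k \sum_l G (scub x y z (delta_mx i j) (delta_mx k l))
                                  (delta_mx j i) (delta_mx l k).
Proof.
move=> G1 G2 G3.
have br1 (u : mx) : bracket u 1%:M = 0 by rewrite /bracket mulmx1 mul1mx subrr.
have br0l (u : mx) : bracket 0 u = 0 by rewrite /bracket mulmx0 mul0mx subrr.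
have br0r (u : mx) : bracket u 0 = 0 by rewrite /bracket mulmx0 mul0mx subrr.
transitivity (\sum_m \sum_n G (scub x y z (B m) (B n)) (B m) (B n)).
  rewrite exchange_big; apply: eq_bigr => m _ /=.
  rewrite exchange_big; apply: eq_bigr => n _ /=.
  rewrite [in RHS](@basis_expand (scub x y z (B m) (B n))) ?tr_bracket //.
  rewrite (islin_sum _ _ (G1 _ _)); apply: eq_bigr => l _.
  by rewrite trformA.
rewrite exchange_big /=.
under eq_bigr => n _.
  rewrite (casimir (H := fun u v => G (scub x y z u (B n)) v (B n))).
  - over.
  - move=> v; apply: (islin_comp (G1 v (B n))).
    apply: (islin_comp (islin_brr x)); apply: (islin_comp (islin_brr _)).
    exact: islin_brl.
  - by move=> u; apply: G2.
  - by move=> v; rewrite /scub br1 !br0l (islin0 (G1 _ _)).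
rewrite exchange_big; apply: eq_bigr => i _ /=.
rewrite exchange_big; apply: eq_bigr => j _ /=.
rewrite (casimir (H := fun u v => G (scub x y z (delta_mx i j) u) (delta_mx j i) v)) //.
- move=> v; apply: (islin_comp (G1 _ v)).
  apply: (islin_comp (islin_brr x)); apply: (islin_comp (islin_brl _)).
  exact: islin_brl.
by move=> v; rewrite /scub br1 br0r br0l (islin0 (G1 _ _)).
Qed.

Lemma islinD V (f g : mx -> V) : islin f -> islin g -> islin (fun u => f u + g u).
Proof. by move=> hf hg k u v; rewrite hf hg scalerDr addrACA. Qed.

Lemma islinS V (f : mx -> V) s : islin f -> islin (fun u => s *: f u).
Proof. by move=> hf k u v; rewrite hf scalerDr !scalerA mulrC. Qed.

Lemma islin_mull d1 d2 d3 (A : 'M[F]_(d1, d2)) (f : mx -> 'M[F]_(d2, d3)) :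
  islin f -> islin (fun u => A *m f u).
Proof. by move=> hf k u v; rewrite hf mulmxDr -scalemxAr. Qed.

Lemma islin_mulr d1 d2 d3 (A : 'M[F]_(d2, d3)) (f : mx -> 'M[F]_(d1, d2)) :
  islin f -> islin (fun u => f u *m A).
Proof. by move=> hf k u v; rewrite hf mulmxDl -scalemxAl. Qed.

Definition sym6 d (z1 z2 z3 : 'M[F]_d) : 'M[F]_d :=
  z1 *m z2 *m z3 + z1 *m z3 *m z2 + z2 *m z1 *m z3
  + z2 *m z3 *m z1 + z3 *m z1 *m z2 + z3 *m z2 *m z1.

Lemma ycubicE d (X1 X2 X3 : mx -> 'M[F]_d) x y z :
  islin X1 -> islin X2 -> islin X3 ->
  ycubic B X1 X2 X3 x y z = 24%:R^-1 *: \sum_i \sum_j \sum_k \sum_l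
    sym6 (X1 (scub x y z (delta_mx i j) (delta_mx k l)))
         (X2 (delta_mx j i)) (X3 (delta_mx l k)).
Proof.
move=> l1 l2 l3.
rewrite /ycubic (cubic_sum (G := fun a b c => ysym (X1 a) (X2 b) (X3 c))).
- rewrite scaler_sumr; apply: eq_bigr => i _; rewrite scaler_sumr.
  apply: eq_bigr => j _; rewrite scaler_sumr; apply: eq_bigr => k _.
  by rewrite scaler_sumr.
- move=> b c; apply: islinS; do !apply: islinD;
    by do ?[apply: islin_mulr | apply: islin_mull | apply: l1].
- move=> b c; apply: islinS; do !apply: islinD;
    by do ?[apply: islin_mulr | apply: islin_mull | apply: l2].
- move=> b c; apply: islinS; do !apply: islinD;
    by do ?[apply: islin_mulr | apply: islin_mull | apply: l3].
Qed.

End CasimirSums.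

Section NaturalModule.
Variables (F : numFieldType) (N : nat) (B : sl_orthonormal_basis F N) (c : F).
Local Notation mx := 'M[F]_N.

Lemma islin_id : islin (fun x : mx => x). Proof. by []. Qed.

Lemma islin_dual : islin (fun x : mx => - x^T).
Proof. by move=> k u v; rewrite linearP /= opprD scalerN. Qed.

Lemma sym6_nat_sum (x y z : mx) :
  \sum_i \sum_j \sum_k \sum_l
    sym6 (scub x y z (delta_mx i j) (delta_mx k l))
         (delta_mx j i) (delta_mx l k) = 0.
Proof.
rewrite -[RHS](nat_identity x y z).
by do 4!apply: eq_bigr => ? _; rewrite /sym6 /sosym !mulmx1 !mulmxA.
Qed.

Lemma sym6_dual_sum (x y z : mx) :
  \sum_i \sum_j \sum_k \sum_l
    sym6 (- (scub x y z (delta_mx i j) (delta_mx k l))^T)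
         (- (delta_mx j i)^T) (- (delta_mx l k)^T) = 0.
Proof.
have dual6 (u v w : mx) : sym6 (- u^T) (- v^T) (- w^T) = - (sym6 u v w)^T.
  rewrite /sym6 !(mulNmx, mulmxN, opprK) -!trmx_mul -!opprD -!raddfD /=.
  by congr (- (_)^T); rewrite !mulmxA [LHS](AC 6 (6*4*5*2*3*1)).
transitivity (- (\sum_i \sum_j \sum_k \sum_l
    sym6 (scub x y z (delta_mx i j) (delta_mx k l))
         (delta_mx j i) (delta_mx l k))^T : mx).
  do 4!(rewrite raddf_sum -sumrN /=; apply: eq_bigr => ? _).
  exact: dual6.
by rewrite sym6_nat_sum trmx0 oppr0.
Qed.

Lemma bracketZl d (s : F) (u v : 'M[F]_d) : bracket (s *: u) v = s *: bracket u v.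
Proof. by rewrite /bracket -scalemxAl -scalemxAr scalerBr. Qed.

Lemma bracketZr d (s : F) (u v : 'M[F]_d) : bracket u (s *: v) = s *: bracket u v.
Proof. by rewrite /bracket -scalemxAl -scalemxAr scalerBr. Qed.

Lemma bracketN d (u v : 'M[F]_d) : bracket v u = - bracket u v.
Proof. by rewrite /bracket opprB. Qed.

Definition jacobi_poly : seq mon :=
  pbr (pvar 0) (pbr (pvar 1) (pvar 2)) ++
  (pbr (pvar 2) (pbr (pvar 0) (pvar 1)) ++ pbr (pvar 1) (pbr (pvar 2) (pvar 0))).

Lemma jacobi_check : checkrel jacobi_poly [::]. Proof. by vm_compute. Qed.

Lemma jacobi (x y z : mx) :
  bracket x (bracket y z) + bracket z (bracket x y) + bracket y (bracket z x) = 0.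
Proof.
suff : 6%:R *: (bracket x (bracket y z) + bracket z (bracket x y)
    + bracket y (bracket z x)) = 0 :> mx.
  by move/eqP; rewrite scaler_eq0 pnatr_eq0 => /eqP.
rewrite (checkrelP (e := env 0 0 x y z 0 0) (C := fun _ _ _ _ => 0) jacobi_check) //.
- by do 4!(rewrite big1 // => ? _).
- move=> D; have cat3 p1 p2 p3 : psem (env 0 0 x y z 0 0 D) (p1 ++ (p2 ++ p3))
    = psem (env 0 0 x y z 0 0 D) p1 + psem (env 0 0 x y z 0 0 D) p2
      + psem (env 0 0 x y z 0 0 D) p3 by rewrite !psem_cat addrA.
  by rewrite /jacobi_poly cat3 !psem_pbr !psem_pvar.
by move=> *; rewrite /psem big_nil.
Qed.

Lemma evaluation_relations d (X : mx -> 'M[F]_d) :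
  islin X -> (forall x y, bracket (X x) (X y) = X (bracket x y)) ->
  (forall x y z, \sum_i \sum_j \sum_k \sum_l
     sym6 (X (scub x y z (delta_mx i j) (delta_mx k l)))
       (X (delta_mx j i)) (X (delta_mx l k)) = 0) ->
  yangian_relations B X (fun x => c *: X x).
Proof.
move=> Xl Xb X6; have XD u v : X (u + v) = X u + X v.
  by rewrite -[u]scale1r Xl !scale1r.
have XlJ : islin (fun x => c *: X x) by apply: islinS.
split=> [s t x y _ _|x y _ _|s t x y _ _|x y _ _|x y z _ _ _|x y z w _ _ _ _].
- by rewrite Xl (islinZ _ _ Xl).
- exact: Xb.
- by rewrite Xl (islinZ _ _ Xl) scalerDr !scalerA !(mulrC c).
- by rewrite bracketZr Xb.
- rewrite !(bracketZl, bracketZr) !Xb -!scalerDr -!XD jacobi islin0 //.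
  by rewrite !scaler0 ycubicE // X6 scaler0.
- have X0 x1 y1 z1 : ycubic B X X (fun x => c *: X x) x1 y1 z1 = 0.
    rewrite ycubicE //; transitivity (24%:R^-1 *: (c *: \sum_i \sum_j \sum_k \sum_l
      sym6 (X (scub x1 y1 z1 (delta_mx i j) (delta_mx k l)))
        (X (delta_mx j i)) (X (delta_mx l k)))).
      congr (_ *: _).
      do 4!(rewrite scaler_sumr; apply: eq_bigr => ? _).
      by rewrite /sym6 -!scalemxAl -!scalemxAr -!scalemxAl !scalerDr.
    by rewrite X6 !scaler0.
  rewrite !X0 addr0 !(bracketZl, bracketZr) !Xb.
  by rewrite [bracket (bracket z w) _]bracketN -!(islinZ _ _ Xl) -XD -!scalerDr subrr !scaler0 islin0.
Qed.

Lemma nat_relations : yangian_relations B (fun x : mx => x) (fun x => c *: x).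
Proof.
by apply: (evaluation_relations islin_id) => // x y z; apply: sym6_nat_sum.
Qed.

Lemma dual_relations : yangian_relations B (fun x : mx => - x^T) (fun x => c *: - x^T).
Proof.
apply: (evaluation_relations islin_dual) => [x y|x y z]; last exact: sym6_dual_sum.
by rewrite /bracket !(mulNmx, mulmxN, opprK) -!trmx_mul linearB /= opprB.
Qed.

End NaturalModule.

(* V(lambda_1, c) and V(lambda_{N-1}, c) in the standard and the dual basis *)
Definition natural_module (F : numFieldType) (N : nat)
    (B : sl_orthonormal_basis F N) (c : F) : yangian_module B N :=
  YangianModule (nat_relations B c).

Definition dual_module (F : numFieldType) (N : nat)
    (B : sl_orthonormal_basis F N) (c : F) : yangian_module B N :=
  YangianModule (dual_relations B c).

Section TensorModule.
Variables (F : numFieldType) (N : nat) (B : sl_orthonormal_basis F N) (a b : F).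
Local Notation mx := 'M[F]_N.
Local Notation mx2 := 'M[F]_(N * N).
Let a2 := 2%:R * a.
Let b2 := 2%:R * b.
Local Notation tX := (coproduct_act (natural_module B a) (dual_module B b)).
Local Notation tJ := (coproduct_actJ (natural_module B a) (dual_module B b)).

(* V (x) V^* is identified with 'M_N *)
Definition vecT (M : mx) : 'cV[F]_(N * N) :=
  \col_k M (mxtens_unindex k).1 (mxtens_unindex k).2.

Definition rep (A : mx2) (f : mx -> mx) : Prop :=
  forall M, A *m vecT M = vecT (f M).

Lemma vecTD M M' : vecT (M + M') = vecT M + vecT M'.
Proof. by apply/colP => k; rewrite !mxE. Qed.

Lemma vecTZ s M : vecT (s *: M) = s *: vecT M.
Proof. by apply/colP => k; rewrite !mxE. Qed.

Lemma vecT0 : vecT 0 = 0.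
Proof. by apply/colP => k; rewrite !mxE. Qed.

Lemma rep_mul A A' f f' : rep A f -> rep A' f' -> rep (A *m A') (fun M => f (f' M)).
Proof. by move=> h h' M; rewrite -mulmxA h' h. Qed.

Lemma rep_add A A' f f' : rep A f -> rep A' f' -> rep (A + A') (fun M => f M + f' M).
Proof. by move=> h h' M; rewrite mulmxDl h h' vecTD. Qed.

Lemma rep_scale s A f : rep A f -> rep (s *: A) (fun M => s *: f M).
Proof. by move=> h M; rewrite -scalemxAl h vecTZ. Qed.

Lemma rep_opp A f : rep A f -> rep (- A) (fun M => - f M).
Proof. by move=> h M; rewrite -!scaleN1r; apply: rep_scale. Qed.

Lemma rep_br A A' f f' : rep A f -> rep A' f' -> rep (bracket A A') (sobr f f').
Proof. by move=> h h'; apply: rep_add (rep_opp _); apply: rep_mul. Qed.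

Lemma rep_sym6 A1 A2 A3 f g h : rep A1 f -> rep A2 g -> rep A3 h ->
  rep (sym6 A1 A2 A3) (sosym f g h).
Proof.
move=> h1 h2 h3.
have m3 A A' A'' k k' k'' (u : rep A k) (u' : rep A' k') (u'' : rep A'' k'') :=
  rep_mul (rep_mul u u') u''.
exact: rep_add (rep_add (rep_add (rep_add (rep_add (m3 _ _ _ _ _ _ h1 h2 h3)
  (m3 _ _ _ _ _ _ h1 h3 h2)) (m3 _ _ _ _ _ _ h2 h1 h3)) (m3 _ _ _ _ _ _ h2 h3 h1))
  (m3 _ _ _ _ _ _ h3 h1 h2)) (m3 _ _ _ _ _ _ h3 h2 h1).
Qed.

Lemma rep_sum (I : finType) (A : I -> mx2) (f : I -> mx -> mx) :
  (forall i, rep (A i) (f i)) -> rep (\sum_i A i) (fun M => \sum_i f i M).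
Proof.
move=> h M; rewrite mulmx_suml; elim/big_rec2: _ => [|i u v _ ->].
  by rewrite vecT0.
by rewrite h vecTD.
Qed.

Lemma rep_inj A A' f f' : rep A f -> rep A' f' -> f =1 f' -> A = A'.
Proof.
move=> h h' ff'; suff hc k : col k A = col k A'.
  by apply/matrixP => i k; have /colP/(_ i) := hc k; rewrite !mxE.
case: (mxtens_indexP k) => i j; rewrite !colE.
have <- : vecT (delta_mx i j) = delta_mx (mxtens_index (i, j)) 0.
  apply/colP => l; case: (mxtens_indexP l) => i' j'.
  rewrite !mxE mxtens_indexK /= (can_eq (@mxtens_indexK N N)) xpair_eqE.
  by rewrite eqxx andbT.
by rewrite h h' ff'.
Qed.

Lemma rep_tens (u v : mx) : rep (u *t v) (fun M => u *m M *m v^T).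
Proof.
move=> M; apply/colP => k; case: (mxtens_indexP k) => i j; rewrite !mxE.
rewrite mxtens_indexK /=.
rewrite (reindex (@mxtens_index N N)); last first.
  by apply: onW_bij; exists (@mxtens_unindex N N);
    [exact: mxtens_indexK | exact: mxtens_unindexK].
pose g p q := (u *t v) (mxtens_index (i, j)) (mxtens_index (p, q))
    * vecT M (mxtens_index (p, q)) 0.
rewrite (eq_bigr (fun p => g p.1 p.2)) => [|[p q] _ //].
rewrite -(pair_bigA _ g) exchange_big /=.
apply: eq_bigr => q _; rewrite mxE mulr_suml; apply: eq_bigr => p _.
by rewrite /g tensmxE !mxE mxtens_indexK /= mulrAC.
Qed.

Lemma rep_ext A f g : f =1 g -> rep A f -> rep A g.
Proof. by move=> fg h M; rewrite h fg. Qed.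

Lemma rep_tX x : rep (tX x) (bracket x).
Proof.
apply: (rep_ext _ (rep_add (rep_tens _ _) (rep_tens _ _))) => M /=.
by rewrite trmx1 mulmx1 mul1mx raddfN /= trmxK mulmxN.
Qed.

Lemma sum_delta_conj (A : mx) :
  \sum_i \sum_j delta_mx i j *m A *m delta_mx j i = (\tr A)%:M :> mx.
Proof.
apply: tr_eq => D; rewrite mul_mx_scalar mxtraceZ -contract_tr1.
rewrite mulmx_sumr raddf_sum; apply: eq_bigr => i _.
rewrite mulmx_sumr raddf_sum; apply: eq_bigr => j _ /=.
by rewrite mxtrace_mulC !mulmxA.
Qed.

Lemma rep_casimir x :
  rep (bracket (x *t 1%:M) (\sum_l (B l : mx) *t (- (B l : mx)^T)))
      (fun M => (\tr (x *m M))%:M - \tr M *: x).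
Proof.
have -> : bracket (x *t (1%:M : mx)) (\sum_l (B l : mx) *t (- (B l : mx)^T))
    = \sum_i \sum_j bracket x (delta_mx i j) *t (- (delta_mx j i : mx)^T).
  have tZl (s : F) (u v : mx) : (s *: u) *t v = s *: (u *t v).
    by apply/matrixP => i j; rewrite !mxE mulrA.
  have tZr (s : F) (u v : mx) : u *t (s *: v) = s *: (u *t v).
    by apply/matrixP => i j; rewrite !mxE mulrCA.
  have tDl (u u' v : mx) : (u + u') *t v = u *t v + u' *t v.
    by apply/matrixP => i j; rewrite !mxE mulrDl.
  have tDr (u v v' : mx) : u *t (v + v') = u *t v + u *t v'.
    by apply/matrixP => i j; rewrite !mxE mulrDr.
  have tNl (u v : mx) : (- u) *t v = - (u *t v).
    by rewrite -scaleN1r tZl scaleN1r.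
  rewrite -(casimir B (H := fun u v => bracket x u *t (- v^T))).
  - rewrite /bracket mulmx_sumr mulmx_suml -sumrB; apply: eq_bigr => l _.
    by rewrite !tensmx_mul mulmx1 mul1mx tDl tNl.
  - by move=> v k u u'; rewrite islin_brl tDl tZl.
  - by move=> u k v v'; rewrite islin_dual tDr tZr.
  - by move=> v; rewrite /bracket mulmx1 mul1mx subrr tens0mx.
apply: (rep_ext _ (rep_sum (fun i => rep_sum (fun j => rep_tens _ _)))) => M /=.
transitivity (- (x *m (\tr M)%:M) + (\tr (x *m M))%:M : mx).
  rewrite -!sum_delta_conj mulmx_sumr -sumrN -big_split; apply: eq_bigr => i _ /=.
  rewrite mulmx_sumr -sumrN -big_split; apply: eq_bigr => j _ /=.
  by rewrite raddfN /= trmxK mulmxN /bracket !mulmxBl opprB addrC !mulmxA.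
by rewrite mul_mx_scalar addrC.
Qed.

Lemma rep_tJ x : rep (2%:R *: tJ x) (sJ a2 b2 x).
Proof.
have -> : 2%:R *: tJ x = b2 *: (1%:M *t - x^T) + a2 *: (x *t 1%:M)
    + bracket (x *t 1%:M) (\sum_l (B l : mx) *t (- (B l : mx)^T)).
  rewrite /coproduct_actJ /=; move: (bracket _ _) => T.
  rewrite !scalerDr scalerA divff ?scale1r ?pnatr_eq0 //.
  congr (_ + _ + _); apply/matrixP => i j; rewrite !mxE.
    by rewrite /b2 -[RHS]mulrA; congr (_ * _); rewrite mulrCA.
  by rewrite /a2 !mulrA.
have h := rep_add (rep_add (rep_scale b2 (rep_tens 1%:M (- x^T)))
  (rep_scale a2 (rep_tens x 1%:M))) (rep_casimir x).
apply: (rep_ext _ h) => M /=.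
rewrite trmx1 mulmx1 mul1mx raddfN /= trmxK mulmxN scalerN /sJ.
by rewrite [X in X + _]addrC -!addrA; congr (_ + (_ + _)); rewrite addrC.
Qed.

Lemma sJ_lin (M : mx) : islin ((sJ a2 b2)^~ M).
Proof.
rewrite /sJ; apply: islinD; first apply: islinD; first apply: islinD.
- by apply: islinS; apply: islin_mulr.
- move=> k u v; rewrite mulmxDr -scalemxAr scalerDr opprD scalerN !scalerA.
  by rewrite mulrC.
- by move=> k u v; rewrite scalerDr opprD scalerN !scalerA mulrC.
move=> k u v; rewrite mulmxDl -scalemxAl mxtraceD mxtraceZ raddfD /=.
by rewrite scale_scalar_mx.
Qed.

Lemma islin_tX : islin tX.
Proof.
move=> k u v.
apply: (rep_inj (rep_tX _) (rep_add (rep_scale k (rep_tX u)) (rep_tX v))) => M.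
exact: islin_brr.
Qed.

Lemma islin_2tJ : islin (fun x => 2%:R *: tJ x).
Proof.
move=> k u v.
apply: (rep_inj (rep_tJ _) (rep_add (rep_scale k (rep_tJ u)) (rep_tJ v))) => M.
exact: sJ_lin.
Qed.

Lemma tJE x : tJ x = 2%:R^-1 *: (2%:R *: tJ x).
Proof. by rewrite scalerA mulVf ?scale1r // pnatr_eq0. Qed.

Lemma islin_tJ : islin tJ.
Proof.
move=> k u v; rewrite (tJE (_ + _)) (tJE u) (tJE v).
exact: (islinS _ islin_2tJ).
Qed.

Definition XX_lhs : seq mon :=
  pobr (pbr (pvar 0)) (pbr (pvar 1)) (pvar 4)
  ++ popp (pbr (pbr (pvar 0) (pvar 1)) (pvar 4)).
Definition XJ_lhs : seq mon :=
  pobr (pbr (pvar 0)) (pJ (pvar 1)) (pvar 4)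
  ++ popp (pJ (pbr (pvar 0) (pvar 1)) (pvar 4)).

Lemma XX_check : checkrel XX_lhs [::]. Proof. by vm_compute. Qed.
Lemma XJ_check : checkrel XJ_lhs [::]. Proof. by vm_compute. Qed.

Lemma checkrel0P (L : seq mon) (e : mx -> nat -> mx) (A A' : mx) :
  checkrel L [::] -> (forall D, e D 5%N = D) ->
  (forall D, psem (e D) L = A - A') -> A = A'.
Proof.
move=> h e5 hL; apply/eqP; rewrite -subr_eq0.
suff /eqP : 6%:R *: (A - A') = 0 by rewrite scaler_eq0 pnatr_eq0.
rewrite (checkrelP (C := fun _ _ _ _ => 0) h e5 hL); last first.
  by move=> *; rewrite /psem big_nil.
by do 4!(rewrite big1 // => ? _).
Qed.

Lemma XX_identity (x y M : mx) : sobr (bracket x) (bracket y) M = bracket (bracket x y) M.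
Proof.
apply: (checkrel0P (e := env 0 0 x y 0 0 M) XX_check) => // D.
rewrite /XX_lhs psem_cat psem_popp (psem_pobr (psem_pbr _ _) (psem_pbr _ _)).
by rewrite !psem_pbr !psem_pvar.
Qed.

Lemma XJ_identity (x y M : mx) : (0 < N)%N ->
  sobr (bracket x) (sJ a2 b2 y) M = sJ a2 b2 (bracket x y) M.
Proof.
move=> N_gt0; apply: (checkrel0P (e := env a2 b2 x y 0 0 M) XJ_check) => // D.
set e := env _ _ _ _ _ _ _ _.
have hJ u p : psem e (pJ u p) = sJ a2 b2 (psem e u) (psem e p).
  by apply: psem_pJ; apply: tr_scal.
rewrite /XJ_lhs psem_cat psem_popp (psem_pobr (psem_pbr _ _) (hJ _)).
by rewrite hJ !psem_pbr !psem_pvar.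
Qed.

Lemma scale_JJ d (u1 v1 u2 v2 u3 v3 : 'M[F]_d) :
  4%:R *: (bracket u1 v1 + bracket u2 v2 + bracket u3 v3) =
  bracket (2%:R *: u1) (2%:R *: v1) + bracket (2%:R *: u2) (2%:R *: v2)
  + bracket (2%:R *: u3) (2%:R *: v3).
Proof.
have e4 : 2%:R * 2%:R = 4%:R :> F by rewrite -natrM.
by rewrite !(bracketZl, bracketZr) !scalerA e4 -!scalerDr.
Qed.

Lemma scale_JJJ d (x y z w u1 u2 : 'M[F]_d) :
  8%:R *: (bracket (bracket x y) (bracket u1 w) + bracket (bracket z w) (bracket u2 y))
  = bracket (bracket (2%:R *: x) (2%:R *: y)) (bracket u1 (2%:R *: w))
  + bracket (bracket (2%:R *: z) (2%:R *: w)) (bracket u2 (2%:R *: y)).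
Proof.
have e8 : 2%:R * (2%:R * 2%:R) = 8%:R :> F by rewrite -!natrM.
by rewrite !(bracketZl, bracketZr) !scalerA -!mulrA e8 -!scalerDr.
Qed.

Lemma scale_sym6 d (u v w : 'M[F]_d) s : s *: sym6 u v w = sym6 u v (s *: w).
Proof. by rewrite /sym6 !(=^~ scalemxAl, =^~ scalemxAr) -!scalerDr. Qed.

Lemma tensor_relations : yangian_relations B tX tJ.
Proof.
case: (posnP N) => [N0|N_gt0].
  have flat (U W : mx2) : U = W.
    apply/matrixP => i; have := ltn_ord i; move: (nat_of_ord i) => k.
    by rewrite [in (_ < _)%N]N0.
  by split=> *; apply: flat.
have n2 : 2%:R != 0 :> F by rewrite pnatr_eq0.
have n4 : 4%:R != 0 :> F by rewrite pnatr_eq0.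
have n6 : 6%:R != 0 :> F by rewrite pnatr_eq0.
split=> [s t x y _ _|x y _ _|s t x y _ _|x y _ _|x y z _ _ _|x y z w _ _ _ _].
- by rewrite islin_tX (islinZ _ _ islin_tX).
- apply: (rep_inj (rep_br (rep_tX _) (rep_tX _)) (rep_tX _)) => M.
  exact: XX_identity.
- by rewrite islin_tJ (islinZ _ _ islin_tJ).
- rewrite (tJE y) (tJE (bracket x y)) bracketZr; congr (_ *: _).
  apply: (rep_inj (rep_br (rep_tX _) (rep_tJ _)) (rep_tJ _)) => M.
  exact: XJ_identity.
- rewrite ycubicE; do ?exact: islin_tX.
  set S := \sum_i _; set L := _ + _.
  suff -> : S = 6%:R *: (4%:R *: L).
    have e24 : 6%:R * 4%:R = 24%:R :> F by rewrite -natrM.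
    by rewrite [6%:R *: _]scalerA e24 scalerA mulVf ?scale1r // pnatr_eq0.
  have -> : 4%:R *: L =
      bracket (2%:R *: tJ x) (2%:R *: tJ (bracket y z))
      + bracket (2%:R *: tJ z) (2%:R *: tJ (bracket x y))
      + bracket (2%:R *: tJ y) (2%:R *: tJ (bracket z x)).
    exact: scale_JJ.
  apply/esym.
  apply: (rep_inj (rep_scale _ (rep_add (rep_add
    (rep_br (rep_tJ _) (rep_tJ _)) (rep_br (rep_tJ _) (rep_tJ _)))
    (rep_br (rep_tJ _) (rep_tJ _)))) (rep_sum (fun i => rep_sum (fun j =>
    rep_sum (fun k => rep_sum (fun l =>
    rep_sym6 (rep_tX _) (rep_tX _) (rep_tX _))))))) => M.
  exact: JJ_identity.
- rewrite !ycubicE; do ?[exact: islin_tX | exact: islin_tJ].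
  rewrite -scalerDr; set S := (X in _ *: X); set L := (X in X = _).
  suff e : 2%:R *: S = 6%:R *: (8%:R *: L).
    have -> : S = 24%:R *: L.
      have e48 : 6%:R * 8%:R = 2%:R * 24%:R :> F by rewrite -!natrM.
      by apply: (scalerI n2); rewrite e [LHS]scalerA [RHS]scalerA e48.
    by rewrite scalerA mulVf ?scale1r // pnatr_eq0.
  have -> : 8%:R *: L =
      bracket (bracket (2%:R *: tJ x) (2%:R *: tJ y)) (bracket (tX z) (2%:R *: tJ w))
      + bracket (bracket (2%:R *: tJ z) (2%:R *: tJ w))
                (bracket (tX x) (2%:R *: tJ y)).
    exact: scale_JJJ.
  have -> : 2%:R *: S = \sum_i \sum_j \sum_k \sum_l
     (sym6 (tX (scub x y (bracket z w) (delta_mx i j) (delta_mx k l)))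
         (tX (delta_mx j i)) (2%:R *: tJ (delta_mx l k))
     + sym6 (tX (scub z w (bracket x y) (delta_mx i j) (delta_mx k l)))
         (tX (delta_mx j i)) (2%:R *: tJ (delta_mx l k))).
    rewrite /S -big_split scaler_sumr; apply: eq_bigr => i _ /=.
    do 3!(rewrite -big_split scaler_sumr; apply: eq_bigr => ? _ /=).
    by rewrite scalerDr; congr (_ + _); apply: scale_sym6.
  apply/esym.
  apply: (rep_inj (rep_scale _ (rep_add
    (rep_br (rep_br (rep_tJ _) (rep_tJ _)) (rep_br (rep_tX _) (rep_tJ _)))
    (rep_br (rep_br (rep_tJ _) (rep_tJ _)) (rep_br (rep_tX _) (rep_tJ _)))))
    (rep_sum (fun i => rep_sum (fun j =>
    rep_sum (fun k => rep_sum (fun l => rep_add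
    (rep_sym6 (rep_tX _) (rep_tX _) (rep_tJ _))
    (rep_sym6 (rep_tX _) (rep_tX _) (rep_tJ _)))))))) => M.
  exact: JJJ_identity.
Qed.

End TensorModule.

Definition tensor_module (F : numFieldType) (N : nat)
    (B : sl_orthonormal_basis F N) (a b : F) : yangian_module B (N * N) :=
  @YangianModule F N B (N * N)
    (coproduct_act (natural_module B a) (dual_module B b))
    (coproduct_actJ (natural_module B a) (dual_module B b))
    (tensor_relations B a b).

Definition omega (R : realType) (N : nat) : R[i] :=
  Complex (cos (2%:R * pi / N%:R)) (sin (2%:R * pi / N%:R)).

(* Indices are positive naturals read modulo N: the p-th coordinate (0 <= p < N)
   carries the label p + 1. *)
Definition munit (F : pzRingType) (N k l : nat) : 'M[F]_N :=
  \matrix_(p, q) ((p.+1 == k %[mod N]) && (q.+1 == l %[mod N]))%:R.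

Definition ket (F : pzRingType) (N k : nat) : 'cV[F]_N :=
  \col_p (p.+1 == k %[mod N])%:R.

Definition Tbasis (R : realType) (N i j : nat) : 'M[R[i]]_N :=
  \sum_(1 <= k < N.+1)
    omega R N ^+ ((i - 1) * (k - 1)) *: munit R[i] N k (k + j - 1).

Definition Psi (R : realType) (N k m : nat) : 'cV[R[i]]_(N * N) :=
  \sum_(1 <= r < N.+1)
    omega R N ^+ ((k - 1) * (r - 1)) *: (ket R[i] N r *t ket R[i] N (m + r - 1)).

Definition deltaN (F : pzRingType) (N k l : nat) : F := (k == l %[mod N])%:R.

(* Main.v *)
Require Import Defs.
From mathcomp Require Import all_boot all_order all_algebra.
From mathcomp Require Import complex mxtens.
From mathcomp Require Import reals trigo.
From mathcomp Require Import zify ring.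
Import Order.TTheory GRing.Theory Num.Theory.
Local Open Scope ring_scope.

(** Identify the tensor product of [C^N] and its dual with the [N x N] matrices.
    Then [Psi_k^(m)] is the matrix [T_k^(m)], and [J(x)] acts by
    [M |-> a x M - b M x + (tr (x M) 1 - tr M x) / 2].
    The formula follows from the clock and shift relation
    [T_i^(j) T_k^(m) = w^((j-1)(k-1)) T_(i+k-1)^(j+m-1)], together with the fact
    that among the [T_i^(j)] only [T_1^(1) = 1] has a nonzero trace. *)

Lemma omegaX (R : realType) (N n : nat) :
  omega R N ^+ n = Complex (cos (2%:R * pi / N%:R *+ n)) (sin (2%:R * pi / N%:R *+ n)).
Proof.
elim: n => [|n IH]; first by rewrite expr0 mulr0n cos0 sin0.
rewrite exprS IH [_ *+ n.+1]mulrS cosD sinD /omega; apply/eqP; rewrite eq_complex /= eqxx /=.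
by rewrite addrC.
Qed.

(** For [0 < n < N], a real part equal to 1 in [w^n] would mean cos(2x) = 1 at x = pi n / N. Then
    sin x = 0, although x lies strictly between 0 and pi. *)
Lemma omega_primitive (R : realType) (N : nat) : (0 < N)%N ->
  N.-primitive_root (omega R N).
Proof.
move=> N_gt0; have N_neq0 : N%:R != 0 :> R by rewrite pnatr_eq0 -lt0n.
rewrite /primitive_root_of_unity N_gt0 /=; apply/forallP => n.
rewrite unity_rootE omegaX eq_complex /=.
have [->|nN] := eqVneq n.+1 N.
  rewrite -[_ *+ N]mulr_natr divfK //.
  by rewrite mulrC [pi * _]mulr_natr cos2pi sin2pi !eqxx.
apply/eqP; rewrite (_ : _ == 1 = false) //; apply/negP => /eqP.
have -> : 2%:R * pi / N%:R *+ n.+1 = (pi * n.+1%:R / N%:R) *+ 2 :> R.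
  by rewrite -mulr_natr -[RHS]mulr_natl !mulrA [LHS]mulrAC.
rewrite cos_mulr2n; set x := _ / _.
have : 0 < sin x.
  apply: sin_gt0_pi; rewrite !mulr_gt0 ?invr_gt0 ?ltr0n ?pi_gt0 //=.
  rewrite ltr_pdivrMr ?ltr0n // ltr_pM2l ?pi_gt0 // ltr_nat.
  by rewrite ltn_neqAle nN ltn_ord.
rewrite lt0r => /andP[sx0 _] cx1; case/negP: sx0.
rewrite -sqrf_eq0 sin2cos2 subr_eq0 eq_sym; apply/eqP.
apply: (@mulIf _ 2%:R); first by rewrite pnatr_eq0.
by rewrite mulr_natr mul1r -[LHS](subrK 1) cx1.
Qed.

Section ClockShift.
Variables (F : comNzRingType) (N : nat) (w : F).
Implicit Types i j k l : nat.

(** The product Z^i X^j of the clock matrix Z = diag(w^p) and the cyclic shift X. Exponents start at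
    0, so the labels (i, j) of [Tbasis] become (i - 1, j - 1). *)
Definition clock_shift i j : 'M[F]_N :=
  \matrix_(p, q) (w ^+ (i * p) * (q == p + j %[mod N])%:R).

Lemma clock_shift00 : clock_shift 0 0 = 1%:M.
Proof.
apply/matrixP => p q; rewrite !mxE mul1r addn0 !modn_small ?ltn_ord //.
by rewrite eq_sym.
Qed.

Hypothesis wN : w ^+ N = 1.

Lemma eq_clock_shift i j k l : i = k %[mod N] -> j = l %[mod N] ->
  clock_shift i j = clock_shift k l.
Proof.
move=> ik jl; apply/matrixP => p q; rewrite !mxE.
by rewrite -(expr_mod _ wN) -modnMml ik modnMml expr_mod // -modnDmr jl modnDmr.
Qed.

(** This is X^j Z^k = w^(jk) Z^k X^j. Since w^N = 1, the wrap-around of p + j modulo N leaves the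
    power of w unchanged. *)
Lemma clock_shiftM i j k l :
  clock_shift i j *m clock_shift k l = w ^+ (j * k) *: clock_shift (i + k) (j + l).
Proof.
apply/matrixP => p q; have N_gt0 : (0 < N)%N by apply: leq_ltn_trans (ltn_ord p).
(* The only column where row [p] of the left factor is nonzero. *)
pose s := Ordinal (ltn_pmod (p + j) N_gt0).
rewrite !mxE (bigD1 s) //= big1 => [|r rs]; last first.
  rewrite !mxE modn_small // (_ : _ == _ = false) ?mulr0 ?mul0r //.
  exact: negbTE rs.
rewrite !mxE /= modn_mod eqxx mulr1 addr0 modnDml addnA.
rewrite -(expr_mod (k * _) wN) modnMmr expr_mod // !mulrA -!exprD.
by congr (w ^+ _ * _); lia.
Qed.

End ClockShift.

(** Geometric sum: multiplied by w^n - 1 it gives w^(nN) - 1 = 0, and w^n = 1 only if N divides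
    n. *)
Lemma sum_primitive_root (F : fieldType) (N : nat) (w : F) (n : nat) :
  N.-primitive_root w -> \sum_(p < N) w ^+ (n * p) = N%:R * (N %| n)%:R.
Proof.
move=> w_prim; under eq_bigr do rewrite exprM.
have [Nn|Nn] := boolP (N %| n)%N.
  have /eqP -> : w ^+ n == 1 by rewrite -(prim_order_dvd w_prim).
  by under eq_bigr do rewrite expr1n; rewrite sumr_const card_ord mulr1.
rewrite mulr0; apply/eqP; have := subrX1 (w ^+ n) N.
rewrite exprAC (prim_expr_order w_prim) expr1n subrr => /esym/eqP.
rewrite mulf_eq0 subr_eq0.
by rewrite -(prim_order_dvd w_prim) (negbTE Nn).
Qed.

(** Whether the shift by j meets the diagonal does not depend on the row, so the trace is a
    geometric sum times that indicator. *)
Lemma tr_clock_shift (F : fieldType) (N : nat) (w : F) (i j : nat) :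
  N.-primitive_root w ->
  \tr (clock_shift F N w i j) = N%:R * (N %| i)%:R * (N %| j)%:R.
Proof.
move=> w_prim; rewrite -(sum_primitive_root _ _ _ _ w_prim) mulr_suml.
apply: eq_bigr => p _; rewrite mxE; congr (_ * _%:R).
by rewrite -{1}[nat_of_ord p]addn0 eqn_modDl mod0n eq_sym.
Qed.

(** Row [p] only receives the summand k = p + 1. Positivity of j keeps the truncated subtraction j -
    1 exact. *)
Lemma Tbasis_clock_shift (R : realType) (N i j : nat) : (0 < j)%N ->
  Tbasis R N i j = clock_shift R[i] N (omega R N) (i - 1) (j - 1).
Proof.
move=> j_gt0; apply/matrixP => p q; rewrite summxE mxE big_add1 big_mkord /=.
have modS u v : (u.+1 == v.+1 %[mod N]) = (u == v %[mod N]).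
  by rewrite -[u.+1]addn1 -[v.+1]addn1 eqn_modDr.
rewrite (bigD1 p) //= big1 => [|r rp]; last first.
  rewrite !mxE modS !(modn_small (ltn_ord _)) eq_sym.
  rewrite (_ : (r == p :> nat) = false) ?mulr0 //.
  exact: negbTE rp.
rewrite !mxE eqxx addr0 [(p.+1 - 1)%N]subn1 /=.
by rewrite (_ : p.+1 + j - 1 = (p + (j - 1)).+1)%N ?modS //; lia.
Qed.

(** Under [vecT] the vector |r, s> corresponds to the matrix unit E_rs, so both sums agree term by
    term. *)
Lemma Psi_vecT (R : realType) (N k m : nat) : Psi R N k m = vecT (Tbasis R N k m).
Proof.
apply/colP => x; case: (mxtens_indexP x) => p q.
rewrite !mxE mxtens_indexK !summxE; apply: eq_bigr => r _.
rewrite !mxE mxtens_indexK /= [(m + r)%N]addnC.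
by case: (_ == _ %[mod N]); rewrite ?mul1r ?mul0r.
Qed.

(** Half of [rep_tJ], which describes 2 J(x) with parameters 2a and 2b. The trace terms come from
    the bracket with t in the coproduct. *)
Lemma tensor_actJ_vecT (F : numFieldType) (N : nat) (B : sl_orthonormal_basis F N)
    (a b : F) (x M : 'M[F]_N) :
  actJ (tensor_module B a b) x *m vecT M
  = vecT (a *: (x *m M) - b *: (M *m x)
          + 2%:R^-1 *: ((\tr (x *m M))%:M - \tr M *: x)).
Proof.
have n2 : 2%:R != 0 :> F by rewrite pnatr_eq0.
rewrite [actJ _]/= tJE -scalemxAl rep_tJ -vecTZ; congr vecT.
rewrite /sJ -addrA [- _ + _%:M]addrC scalerDr scalerBr.
by rewrite !scalerA !mulrA mulVf // !mul1r.
Qed.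

Theorem theorem3p3 (R : realType) (N : nat) (hN : (2 <= N)%N)
    (B : sl_orthonormal_basis R[i] N) (a b : R[i]) (i j k m : nat)
    (hi : (1 <= i <= N)%N) (hj : (1 <= j <= N)%N)
    (hk : (1 <= k <= N)%N) (hm : (1 <= m <= N)%N)
    (hij : (i, j) <> (1%N, 1%N)) :
  let w := omega R N in
  actJ (tensor_module B a b) (Tbasis R N i j) *m Psi R N k m
  = (a * w ^+ ((j - 1) * (k - 1)) - b * w ^+ ((i - 1) * (m - 1))
     + N%:R / 2%:R * (deltaN R[i] N (i + k) 2 * deltaN R[i] N (j + m) 2
                      - deltaN R[i] N k 1 * deltaN R[i] N m 1)
       * w ^+ ((j - 1) * (k - 1)))
    *: Psi R N (k + i - 1) (m + j - 1).
Proof.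
move=> w; have w_prim : N.-primitive_root w by apply: omega_primitive; lia.
have wN := prim_expr_order w_prim.
rewrite !Psi_vecT tensor_actJ_vecT -vecTZ; congr vecT.
case/andP: hi hj hk hm => i_gt0 _ /andP[j_gt0 _] /andP[k_gt0 _] /andP[m_gt0 _].
rewrite !Tbasis_clock_shift; [|lia..].
have delta2E u v : (0 < u)%N -> (0 < v)%N ->
    deltaN R[i] N (u + v) 2 = (N %| (u - 1) + (v - 1))%:R.
  move=> u_gt0 v_gt0; rewrite /deltaN.
  rewrite (_ : u + v = (u - 1 + (v - 1)) + 2)%N; last by lia.
  by rewrite -{2}[2%N]add0n eqn_modDr mod0n.
have delta1E u : (0 < u)%N -> deltaN R[i] N u 1 = (N %| u - 1)%:R.
  move=> u_gt0; rewrite /deltaN -{1}(subnK u_gt0).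
  by rewrite -{3}[1%N]add0n eqn_modDr mod0n.
rewrite !delta2E // !delta1E //.
rewrite (_ : k + i - 1 - 1 = (i - 1) + (k - 1))%N; last by lia.
rewrite (_ : m + j - 1 - 1 = (j - 1) + (m - 1))%N; last by lia.
(* From here i, j, k, m denote the exponents, that is, the labels minus 1. *)
move: (i - 1)%N (j - 1)%N (k - 1)%N (m - 1)%N => {hij i_gt0 j_gt0 k_gt0 m_gt0} {}i {}j {}k {}m.
rewrite !clock_shiftM // mxtraceZ !tr_clock_shift //.
rewrite [(m * i)%N]mulnC [(k + i)%N]addnC [(m + j)%N]addnC.
set T := clock_shift _ _ _ (i + k) (j + m).
(* A nonzero trace forces [T = 1], resp. [M = 1] and [x = T]. *)
have id_part : (N %| i + k)%:R * (N %| j + m)%:R *: 1%:M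
    = (N %| i + k)%:R * (N %| j + m)%:R *: T.
  have [ik|] := boolP (N %| i + k)%N; last by rewrite mul0r !scale0r.
  have [jm|] := boolP (N %| j + m)%N; last by rewrite mulr0 !scale0r.
  rewrite -(clock_shift00 _ _ w) /T; congr (_ *: _).
  by apply: eq_clock_shift => //; rewrite mod0n; apply/esym/eqP.
have x_part : (N %| k)%:R * (N %| m)%:R *: clock_shift R[i] N w i j
    = ((N %| k)%:R * (N %| m)%:R * w ^+ (j * k)) *: T.
  have [Nk|] := boolP (N %| k)%N; last by rewrite !mul0r !scale0r.
  have [Nm|] := boolP (N %| m)%N; last by rewrite mulr0 mul0r !scale0r.
  (* As N divides k, w^(jk) = 1. Carrying this factor gives the term the common power of w in the
     claim. *)
  rewrite -(expr_mod _ wN) (eqP (dvdn_mull j Nk)) expr0 !mulr1.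
  congr (_ *: _); apply: eq_clock_shift => //.
    by rewrite -modnDmr (eqP Nk) addn0.
  by rewrite -modnDmr (eqP Nm) addn0.
have -> : (w ^+ (j * k) * (N%:R * (N %| i + k)%:R * (N %| j + m)%:R))%:M
    = (w ^+ (j * k) * (N%:R * (N %| i + k)%:R * (N %| j + m)%:R)) *: T.
  rewrite -scalemx1 -[N%:R * _ * _]mulrA [w ^+ _ * _]mulrA.
  by rewrite -!(scalerA (_ * N%:R)) id_part.
rewrite -[N%:R * (N %| k)%:R * _]mulrA -(scalerA N%:R) x_part !scalerA.
rewrite -!scalerBl scalerA -scalerDl.
by congr (_ *: _); ring.
Qed.
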